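(* Let $n\ge 1$ and, for each agent $i\in\{1,\dots,n\}$, let $\sigma^i>0$, $\theta_0^i\in\mathbb{R}$, and let $(s_k^i)_{k\ge 1}$ be a sequence of real observations. Suppose that the prior belief density of every agent $i$ on the parameter space $\mathbb{R}$ is the Gaussian function $\bar\mu_0^i=\mathcal{N}(\theta_0^i,(\sigma^i)^2)$, and that the likelihood models are Gaussian: $\ell^i(s|\theta)=\mathcal{N}(\theta,(\sigma^i)^2)$ evaluated at $s$, for all $s,\theta\in\mathbb{R}$. Let the belief densities $\bar\mu_k^i$ be generated by $$\bar\mu_{k+1}^i(\theta)\;\propto\;\prod_{j=1}^n\big(\bar\mu_k^j(\theta)\big)^{a_{ij}}\,\ell^i(s_{k+1}^i|\theta),\qquad k\ge 0,$$ with nonnegative weights $a_{ij}$ (allowed to depend on $k$). Then for every $k\ge1$ and every $i$, the posterior belief density $\bar\mu_k^i$ is also a Gaussian function. Moreover, if at each step $k$ the weights are $a_{ij}=[A_k]_{ij}$, i.e. $a_{ij}=1/(d_k^j+1)$ when $j$ communicates with $i$ at time $k$ and $a_{ij}=0$ otherwise, then for every $k\ge 0$ and every $i$ the mean $\theta_k^i$ of $\bar\mu_k^i$ and the precision $\tau_k^i$ (the reciprocal of the squared standard deviation) of $\bar\mu_k^i$ satisfy $$\tau_{k+1}^i=\sum_{j=1}^n[A_k]_{ij}\tau_k^j+\tau^i,\qquad \theta_{k+1}^i=\frac{\sum_{j=1}^n[A_k]_{ij}\tau_k^j\theta_k^j+s_{k+1}^i\tau^i}{\tau_{k+1}^i},$$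 where $\tau^i=1/(\sigma^i)^2$ and $\tau_0^i=\tau^i$.
   Context: Superscripts index agents $i,j\in\{1,\dots,n\}$ and subscripts $k$ index time; $(\sigma^i)^2$ is the square of the number $\sigma^i$ attached to agent $i$. $\mathcal{N}(\theta,\sigma^2)$ denotes the Gaussian density $x\mapsto \frac{1}{\sqrt{2\pi}\,\sigma}\exp\left(-\frac{(x-\theta)^2}{2\sigma^2}\right)$ on $\mathbb{R}$. The belief density $\bar\mu_k^i$ is a probability density in the parameter $\theta\in\mathbb{R}$ with respect to Lebesgue measure; the symbol $\propto$ means equality up to the normalizing constant (not depending on $\theta$) making the function of $\theta$ integrate to one. Communication: $\{\mathcal{G}_k\}_{k\ge0}$ is a sequence of directed graphs $\mathcal{G}_k=(\{1,\dots,n\},E_k)$, where $(j,i)\in E_k$ with $j\ne i$ means agent $j$ can communicate with agent $i$ at time $k$. Every agent always has access to its own belief, i.e. $j=i$ is always treated as communicating. $d_k^j$ is the out-degree of node $j$ at time $k$ (the number of $i\neq j$ with $(j,i)\in E_k$). The matrix $A_k$ is defined by $[A_k]_{ij}=\frac{1}{d_k^j+1}$ if $(j,i)\in E_k$ or $i=j$, and $[A_k]_{ij}=0$ otherwise; thus $A_k$ is column stochastic with positive diagonal entries. *)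

(* Defs.v *)
From HB Require Import structures.
From mathcomp Require Import all_boot all_order all_algebra.
From mathcomp Require Import all_classical all_reals all_analysis.

Set Implicit Arguments.
Unset Strict Implicit.
Unset Printing Implicit Defensive.

Import Order.TTheory GRing.Theory Num.Theory.
Import numFieldNormedType.Exports.

Local Open Scope ring_scope.

(* [normal_pdf m s] is the density of the normal distribution with mean m and
   STANDARD DEVIATION s (it is a uniform density when s = 0, whence 0 < s). *)
Definition is_gaussian (R : realType) (f : R -> R) : Prop :=
  exists m s : R, 0 < s /\ f = normal_pdf m s.

(* f \propto g is rendered as f = normalize g.  No integrability is assumed:
   x / 0 = 0 in MathComp, so normalize g is the zero function, and not a
   density, when g has integral 0 or +oo. *)
Definition normalize (R : realType) (g : R -> R) : R -> R :=
  fun th => g th / \int[lebesgue_measure]_t g t.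

Definition density_mean (R : realType) (f : R -> R) : R :=
  \int[lebesgue_measure]_t (t * f t).

Definition density_std (R : realType) (f : R -> R) : R :=
  Num.sqrt (\int[lebesgue_measure]_t ((t - density_mean f) ^+ 2 * f t)).

Definition density_precision (R : realType) (f : R -> R) : R :=
  (density_std f ^+ 2)^-1.

(* A directed graph on the agents is a relation [E], where [E j i] means that
   j can communicate with i; loops [E j j] are irrelevant in both definitions
   below. *)
Definition out_degree (n : nat) (E : rel 'I_n) (j : 'I_n) : nat :=
  #|[set i : 'I_n | (i != j) && E j i]|.

Definition comm_weights (R : realType) (n : nat) (E : rel 'I_n) : 'M[R]_n :=
  \matrix_(i, j)
    (if E j i || (i == j) then ((out_degree E j)%:R + 1)^-1 else 0).

(* Main.v *)
Require Import Defs.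
From HB Require Import structures.
From mathcomp Require Import all_boot all_order all_algebra.
From mathcomp Require Import all_classical all_reals all_analysis.
From mathcomp Require Import measurable_realfun ring lra.

(** Up to a positive factor, a Gaussian density with mean m and precision tau
    is the exponential of the quadratic polynomial
    [tau * m * x - tau * x^2 / 2]; this is [gauss_kernel tau (tau * m) x], the
    kernel with natural parameters [tau] and [b = tau * m].  Raising a kernel
    to the power a multiplies both parameters by a ([gauss_kernel_powR]), and
    multiplying kernels adds the parameters ([gauss_kernelM],
    [prod_gauss_kernel]).  The likelihood is symmetric in the observation and
    the parameter ([normal_pdf_sym]), hence is also a Gaussian in the parameter.
    One step of the recursion therefore produces, up to a positive constant, a
    kernel whose precision is the weighted sum of the precisions plus that of
    the observation, and whose b is the corresponding weighted sum of the
    precision-weighted means.  The precision is positive because the weights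
    are nonnegative, so normalizing yields the Gaussian with mean [b / tau]
    and standard deviation [1 / sqrt tau] ([gaussian_update]); by induction all
    beliefs are Gaussian.

    To turn this into the formulas for [density_mean] and [density_precision],
    which are integrals, it remains to know that the mean and variance of
    [normal_pdf m s] are m and s^2 ([density_mean_normal_pdf],
    [density_precision_normal_pdf]).  Both come from the fundamental theorem
    of calculus on the intervals [m - N, m + N] with N going to infinity
    ([Rintegral_FTC_symmetric]), applied to the primitives [- s^2 * pdf] of
    [(x - m) * pdf] and [- s^2 * (x - m) * pdf] of
    [(x - m)^2 * pdf - s^2 * pdf].  Integrability and the decay at infinity
    both follow from the domination of [(x - m)^2 * pdf] by a multiple of
    a wider Gaussian density ([sqr_normal_pdf_le]). *)

Import Order.TTheory GRing.Theory Num.Theory.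
Import numFieldNormedType.Exports.

Local Open Scope ring_scope.
Local Open Scope classical_set_scope.

(** * Integration on the real line *)

(** The integral of an integrable derivative is the limit of the increments of
    the primitive over intervals centered at m: by dominated convergence, the
    integrals over these intervals tend to the integral over the line. *)
Lemma Rintegral_FTC_symmetric {R : realType} (f F : R -> R) (m l : R) :
  continuous f ->
  lebesgue_measure.-integrable [set: R] (EFin \o f) ->
  (forall x : R, is_derive x 1 F (f x)) ->
  F (m + n.+1%:R) - F (m - n.+1%:R) @[n --> \oo] --> l ->
  \int[lebesgue_measure]_t f t = l.
Proof.
move=> cf intf dF limF.
pose I n := `[m - n.+1%:R, m + n.+1%:R].
have cF : continuous (F : R -> R).
  by move=> x; apply/differentiable_continuous/derivable1_diffP; apply: ex_derive.
have FTC n : (\int[lebesgue_measure]_(t in (I n)) (f t)%:E)%E =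
    (F (m + n.+1%:R) - F (m - n.+1%:R))%:E.
  rewrite /I (@continuous_FTC2 _ _ F) ?EFinB//.
  - by rewrite ltrBlDr -addrA ltrDl addr_gt0.
  - exact: continuous_subspaceT.
  - split; first by move=> x _; apply: ex_derive.
    + exact/cvg_at_right_filter/cF.
    + exact/cvg_at_left_filter/cF.
  - by move=> x _; rewrite derive1E derive_val.
have : (\int[lebesgue_measure]_(t in [set: R])
          ((EFin \o f) \_ (I n)) t)%E @[n --> \oo] -->
       (\int[lebesgue_measure]_(t in [set: R]) (f t)%:E)%E.
  have := @dominated_cvg _ _ _ lebesgue_measure _ measurableT
    (fun n => (EFin \o f) \_ (I n)) (EFin \o f) (abse \o (EFin \o f)).
  apply => //.
  - move=> n; apply: (measurable_int lebesgue_measure).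
    apply/(integrable_mkcond _ _).1; first exact: measurable_itv.
    by apply: integrableS intf => //; exact: measurable_itv.
  (* Each x eventually lies in I n. *)
  - move=> x _; apply: cvg_near_cst; near=> n.
    rewrite patchE mem_set// /I/= in_itv/= -ler_distlC distrC ltW//.
    rewrite (lt_le_trans _ (_ : n%:R <= _)) ?ler_nat//.
    by near: n; exact: nbhs_infty_gtr.
  - exact: integrable_abse.
  - move=> n x _; rewrite patchE; case: ifP => // _.
    by rewrite (_ : point = 0%E)// abse0; exact: abse_ge0.
have intE : (\int[lebesgue_measure]_(t in [set: R]) (f t)%:E =
    (\int[lebesgue_measure]_t f t)%:E)%E.
  by rewrite fineK// integrable_fin_num.
rewrite intE => /fine_cvg /(cvg_lim (@Rhausdorff R)) <-.
rewrite -(cvg_lim (@Rhausdorff R) limF); congr (lim (_ @ \oo)).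
by apply/funext => n /=; rewrite -integral_mkcond FTC.
Unshelve. all: by end_near.
Qed.

Lemma le_integrable_lebesgue {R : realType} (f g : R -> R) :
  measurable_fun [set: R] f -> (forall x, `|f x| <= g x) ->
  lebesgue_measure.-integrable [set: R] (EFin \o g) ->
  lebesgue_measure.-integrable [set: R] (EFin \o f).
Proof.
move=> mf fg; have := @le_integrable _ _ R lebesgue_measure setT measurableT
  (EFin \o f) (EFin \o g); apply; first exact/measurable_EFinP.
by move=> x _; rewrite !abse_EFin lee_fin (le_trans (fg x))// ler_norm.
Qed.

(** * Moments of the Gaussian density *)

Lemma normal_pdf_sym {R : realType} (x m s : R) : 0 < s ->
  normal_pdf m s x = normal_pdf x s m.
Proof.
by move=> s0; rewrite !normal_pdfE ?gt_eqF// /normal_fun -sqrrN opprB.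
Qed.

Lemma normal_pdf_reflect {R : realType} (m : R) {s : R} (x : R) : 0 < s ->
  normal_pdf m s (m - x) = normal_pdf m s (m + x).
Proof.
move=> s0; rewrite !normal_pdfE ?gt_eqF// /normal_fun.
by rewrite (_ : m + x - m = - (m - x - m)) ?sqrrN//; ring.
Qed.

Lemma is_derive_normal_pdf {R : realType} (m : R) {s : R} (x : R) : 0 < s ->
  is_derive x 1 (normal_pdf m s) (- (x - m) / s ^+ 2 * normal_pdf m s x).
Proof.
move=> s0; rewrite normal_pdfE ?gt_eqF//.
rewrite /normal_fun; apply: is_derive_eq.
rewrite /GRing.scale/=.
set e := expR _.
by field; rewrite gt_eqF.
Qed.

(** With [y = (x - m)^2 / (4 s^2)], the left-hand side is a multiple of
    [y * exp (- 2 y)] and the right-hand side of [exp (- y)], and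
    [y * exp (- y) <= 1]. *)
Lemma sqr_normal_pdf_le {R : realType} (m : R) {s : R} : 0 < s ->
  exists2 C : R, 0 <= C & forall x,
    (x - m) ^+ 2 * normal_pdf m s x <= C * normal_pdf m (Num.sqrt 2 * s) x.
Proof.
move=> s0.
have r0 : 0 < Num.sqrt 2 * s by rewrite mulr_gt0// sqrtr_gt0.
exists (4 * s ^+ 2 * normal_peak s / normal_peak (Num.sqrt 2 * s)).
  by rewrite divr_ge0 ?normal_peak_ge0// !mulr_ge0 ?normal_peak_ge0 ?(ltW s0).
move=> x; rewrite !normal_pdfE ?gt_eqF// [leRHS]mulrA.
rewrite divfK ?gt_eqF ?normal_peak_gt0 ?gt_eqF//.
rewrite mulrCA [leRHS]mulrAC [leRHS]mulrC ler_wpM2l ?normal_peak_ge0//.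
rewrite /normal_fun exprMn sqr_sqrtr//.
set y := (x - m) ^+ 2 / (4 * s ^+ 2).
have s_neq0 : s != 0 by rewrite gt_eqF.
have -> : - (x - m) ^+ 2 / (s ^+ 2 *+ 2) = - y + - y by rewrite /y; field.
have -> : - (x - m) ^+ 2 / ((2 * s ^+ 2) *+ 2) = - y by rewrite /y; field.
have -> : (x - m) ^+ 2 = 4 * s ^+ 2 * y by rewrite /y; field.
have ye1 : y * expR (- y) <= 1.
  rewrite expRN ler_pdivrMr ?expR_gt0// mul1r.
  by rewrite (le_trans _ (expR_ge1Dx y))// lerDr.
rewrite expRD.
rewrite [leLHS](_ : _ = 4 * s ^+ 2 * expR (- y) * (y * expR (- y)));
  last by ring.
by rewrite ler_piMr// !mulr_ge0 ?expR_ge0 ?(ltW s0).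
Qed.

Lemma continuous_poly_normal_pdf {R : realType} (m : R) {s : R} (p : {poly R}) :
  0 < s -> continuous (fun x : R => p.[x] * normal_pdf m s x).
Proof.
move=> s0 x; apply: cvgM; first exact: continuous_horner.
by apply: continuous_normal_pdf; rewrite gt_eqF.
Qed.

Lemma integrable_sqr_normal_pdf {R : realType} (m : R) {s : R} : 0 < s ->
  lebesgue_measure.-integrable [set: R]
    (EFin \o (fun x : R => (x - m) ^+ 2 * normal_pdf m s x)).
Proof.
move=> s0; have [C C0 leC] := sqr_normal_pdf_le m s0.
apply: (le_integrable_lebesgue _ (fun x => C * normal_pdf m (Num.sqrt 2 * s) x)).
- apply: measurable_funM; last exact: measurable_normal_pdf.
  by apply: measurable_funX; apply: measurable_funB.
- move=> x; rewrite ger0_norm ?leC//.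
  by rewrite mulr_ge0// ?normal_pdf_ge0// sqr_ge0.
- have := integrableZl measurableT C (integrable_normal_pdf m (Num.sqrt 2 * s)).
  exact.
Qed.

Lemma integrable_center_normal_pdf {R : realType} (m : R) {s : R} : 0 < s ->
  lebesgue_measure.-integrable [set: R]
    (EFin \o (fun x : R => (x - m) * normal_pdf m s x)).
Proof.
move=> s0.
apply: (le_integrable_lebesgue _
  (fun x => normal_pdf m s x + (x - m) ^+ 2 * normal_pdf m s x)).
- apply: measurable_funM; last exact: measurable_normal_pdf.
  exact: measurable_funB.
- move=> x; have p0 := normal_pdf_ge0 m s x.
  rewrite normrM (ger0_norm p0).
  have -> : forall a b : R, a + b * a = (1 + b) * a by move=> a b; ring.
  rewrite ler_wpM2r//.
  rewrite -(real_normK (num_real (x - m))).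
  by have := sqr_ge0 (`|x - m| - 1); nra.
- have := integrableD measurableT (integrable_normal_pdf m s)
    (integrable_sqr_normal_pdf m s0).
  exact.
Qed.

Lemma Rintegral_normal_pdf {R : realType} (m s : R) :
  \int[lebesgue_measure]_t normal_pdf m s t = 1.
Proof. by rewrite /Rintegral integral_normal_pdf. Qed.

Lemma Rintegral_center_normal_pdf {R : realType} (m : R) {s : R} : 0 < s ->
  \int[lebesgue_measure]_t ((t - m) * normal_pdf m s t) = 0.
Proof.
move=> s0.
apply: (@Rintegral_FTC_symmetric _ _ (fun x : R => - s ^+ 2 * normal_pdf m s x) m).
- move=> x; have := continuous_poly_normal_pdf m ('X - m%:P) s0 x.
  by under eq_fun do rewrite hornerXsubC.
- exact: integrable_center_normal_pdf.
- move=> x; have ? := is_derive_normal_pdf m x s0.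
  apply: is_derive_eq.
  rewrite /GRing.scale/=.
  by field; rewrite gt_eqF.
- apply: cvg_near_cst; near=> n.
  by rewrite normal_pdf_reflect// subrr.
Unshelve. all: by end_near.
Qed.

Lemma Rintegral_sqr_normal_pdf {R : realType} (m : R) {s : R} : 0 < s ->
  \int[lebesgue_measure]_t ((t - m) ^+ 2 * normal_pdf m s t) = s ^+ 2.
Proof.
move=> s0.
have int2 := integrable_sqr_normal_pdf m s0.
have int0 : lebesgue_measure.-integrable [set: R]
    (EFin \o (fun x => s ^+ 2 * normal_pdf m s x)).
  by have := integrableZl measurableT (s ^+ 2) (integrable_normal_pdf m s); exact.
have : \int[lebesgue_measure]_t
    ((t - m) ^+ 2 * normal_pdf m s t - s ^+ 2 * normal_pdf m s t) = 0.
  apply: (@Rintegral_FTC_symmetric _ _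
    (fun x : R => - s ^+ 2 * ((x - m) * normal_pdf m s x)) m).
  - move=> x; have := continuous_poly_normal_pdf m
      (('X - m%:P) ^+ 2 - (s ^+ 2)%:P) s0 x.
    by under eq_fun do rewrite hornerD hornerN hornerC horner_exp hornerXsubC mulrBl.
  - by have := integrableB measurableT int2 int0; exact.
  - move=> x; have ? := is_derive_normal_pdf m x s0.
    apply: is_derive_eq.
    rewrite /GRing.scale/=.
    by field; rewrite gt_eqF.
  (* The increment is [- 2 s^2 N p] with N = n + 1 and p the density at m + N.
     As [N^2 p] is bounded, the increment lies between [- K / N] and 0. *)
  - have [C C0 leC] := sqr_normal_pdf_le m s0.
    have r0 : Num.sqrt 2 * s != 0 by rewrite mulf_neq0 ?gt_eqF// sqrtr_gt0.
    pose K := 2 * s ^+ 2 * (C * normal_peak (Num.sqrt 2 * s)).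
    apply: (@squeeze_cvgr _ _ _ _ (fun n => - K * n.+1%:R^-1) (fun=> 0)).
    + near=> n.
      rewrite normal_pdf_reflect//.
      set p := normal_pdf _ _ _; have p0 : 0 <= p := normal_pdf_ge0 _ _ _.
      have N0 : 0 < n.+1%:R :> R by [].
      rewrite [X in _ <= X <= _](_ : _ = - (2 * s ^+ 2 * (n.+1%:R * p)));
        last by ring.
      rewrite oppr_le0 mulNr lerN2; apply/andP; split; last first.
        by rewrite !mulr_ge0// (ltW s0).
      rewrite ler_pdivlMr// /K -(mulrA _ _ n.+1%:R) ler_wpM2l ?mulr_ge0 ?(ltW s0)//.
      have := leC (m + n.+1%:R); rewrite -/p.
      have -> : m + n.+1%:R - m = n.+1%:R by ring.
      move=> pC.
      rewrite mulrAC -expr2.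
      apply: (le_trans pC); rewrite ler_wpM2l//.
      exact: normal_pdf_ub.
    + rewrite -[X in _ --> X](mulr0 (- K)); apply: cvgMr; exact: cvg_harmonic.
    + exact: cvg_cst.
rewrite RintegralB// RintegralZl//; last exact: integrable_normal_pdf.
by rewrite Rintegral_normal_pdf mulr1 => /eqP; rewrite subr_eq0 => /eqP.
Unshelve. all: by end_near.
Qed.

Lemma density_mean_normal_pdf {R : realType} (m : R) {s : R} : 0 < s ->
  density_mean (normal_pdf m s) = m.
Proof.
move=> s0; rewrite /density_mean.
have int1 := integrable_center_normal_pdf m s0.
have int0 : lebesgue_measure.-integrable [set: R]
    (EFin \o (fun x => m * normal_pdf m s x)).
  by have := integrableZl measurableT m (integrable_normal_pdf m s); exact.
transitivity (\int[lebesgue_measure]_t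
    ((t - m) * normal_pdf m s t + m * normal_pdf m s t)).
  by apply: eq_Rintegral => t _; ring.
rewrite RintegralD// RintegralZl//; last exact: integrable_normal_pdf.
by rewrite Rintegral_center_normal_pdf// Rintegral_normal_pdf mulr1 add0r.
Qed.

Lemma density_precision_normal_pdf {R : realType} (m : R) {s : R} : 0 < s ->
  density_precision (normal_pdf m s) = (s ^+ 2)^-1.
Proof.
move=> s0; rewrite /density_precision /density_std density_mean_normal_pdf//.
by rewrite Rintegral_sqr_normal_pdf// sqr_sqrtr// sqr_ge0.
Qed.

(** * Normalization and natural parameters *)

Lemma normalize_scale_normal_pdf {R : realType} (c m s : R) : c != 0 ->
  normalize (fun x => c * normal_pdf m s x) = normal_pdf m s.
Proof.
move=> c0; apply/funext => x; rewrite /normalize RintegralZl//; last first.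
  exact: integrable_normal_pdf.
by rewrite Rintegral_normal_pdf mulr1 mulrAC divff// mul1r.
Qed.

(** The unnormalized Gaussian function with precision [tau] and mean [b / tau],
    in natural parameters: the exponent is linear in [(tau, b)].  The factor
    [exp (- b^2 / (2 tau))] that would complete the square is left out. *)
Definition gauss_kernel {R : realType} (tau b x : R) : R :=
  expR (b * x - tau * x ^+ 2 / 2).

Lemma normal_pdf_gauss_kernel {R : realType} (m s x : R) : 0 < s ->
  normal_pdf m s x = normal_peak s * expR (- (s ^+ 2)^-1 * m ^+ 2 / 2) *
                     gauss_kernel (s ^+ 2)^-1 ((s ^+ 2)^-1 * m) x.
Proof.
move=> s0; rewrite normal_pdfE ?gt_eqF// -mulrA -expRD /normal_fun.
congr (_ * expR _); field; by rewrite gt_eqF.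
Qed.

Lemma normalize_gauss_kernel {R : realType} (c tau b : R) : 0 < c -> 0 < tau ->
  normalize (fun x => c * gauss_kernel tau b x) =
  normal_pdf (b / tau) (Num.sqrt tau)^-1.
Proof.
move=> c0 tau0; set m := b / tau; set s := _^-1.
have s0 : 0 < s by rewrite invr_gt0 sqrtr_gt0.
have stau : (s ^+ 2)^-1 = tau by rewrite exprVn invrK sqr_sqrtr// ltW.
pose d := normal_peak s * expR (- tau * m ^+ 2 / 2).
have d0 : 0 < d by rewrite mulr_gt0 ?expR_gt0// normal_peak_gt0// gt_eqF.
rewrite -(@normalize_scale_normal_pdf _ (c / d)); last by rewrite gt_eqF ?divr_gt0.
congr normalize; apply/funext => x; rewrite normal_pdf_gauss_kernel// stau -/d.
by rewrite mulrA divfK ?gt_eqF// /m mulrC [tau * _]mulrC divfK ?gt_eqF// mulrC.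
Qed.

Lemma gauss_kernel_powR {R : realType} (tau b x a : R) :
  gauss_kernel tau b x `^ a = gauss_kernel (a * tau) (a * b) x.
Proof. by rewrite -expRM; congr expR; ring. Qed.

Lemma gauss_kernelM {R : realType} (tau1 tau2 b1 b2 x : R) :
  gauss_kernel tau1 b1 x * gauss_kernel tau2 b2 x =
  gauss_kernel (tau1 + tau2) (b1 + b2) x.
Proof. by rewrite -expRD; congr expR; ring. Qed.

Lemma prod_gauss_kernel {R : realType} {I : finType} (tau b : I -> R) (x : R) :
  \prod_i gauss_kernel (tau i) (b i) x =
  gauss_kernel (\sum_i tau i) (\sum_i b i) x.
Proof.
rewrite /gauss_kernel -expR_sum; congr expR.
by rewrite sumrB -mulr_suml -!mulr_suml.
Qed.

(** * The belief recursion *)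

(** One step of the recursion for one agent: w are its weights, m and s the
    means and standard deviations of the current beliefs, y its observation
    and sigma the standard deviation of its likelihood. *)
Lemma gaussian_update {R : realType} {I : finType} (w m s : I -> R)
    (y sigma : R) : (forall j, 0 <= w j) -> (forall j, 0 < s j) -> 0 < sigma ->
  let tau := \sum_j w j * (s j ^+ 2)^-1 + (sigma ^+ 2)^-1 in
  0 < tau /\
  normalize (fun x => \prod_j (normal_pdf (m j) (s j) x `^ w j) *
                      normal_pdf x sigma y) =
  normal_pdf ((\sum_j w j * (s j ^+ 2)^-1 * m j + y * (sigma ^+ 2)^-1) / tau)
             (Num.sqrt tau)^-1.
Proof.
move=> w0 s0 sigma0 tau.
have tau0 : 0 < tau.
  apply: ltr_wpDl; last by rewrite invr_gt0 exprn_gt0.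
  by apply: sumr_ge0 => j _; rewrite mulr_ge0// invr_ge0 sqr_ge0.
split=> //.
(* K m s is the factor between normal_pdf m s and its kernel. *)
pose K (m s : R) := normal_peak s * expR (- (s ^+ 2)^-1 * m ^+ 2 / 2).
have K0 (m' s' : R) : 0 < s' -> 0 < K m' s'.
  by move=> s'0; rewrite mulr_gt0 ?expR_gt0// normal_peak_gt0// gt_eqF.
pose c := \prod_j (K (m j) (s j) `^ w j) * K y sigma.
have c0 : 0 < c.
  rewrite mulr_gt0 ?K0//; apply: prodr_gt0 => j _; exact/powR_gt0/K0.
rewrite -(@normalize_gauss_kernel _ c)//; congr normalize; apply/funext => x.
rewrite normal_pdf_sym// (normal_pdf_gauss_kernel y)// -/(K y sigma).
under eq_bigr => j _.
  rewrite normal_pdf_gauss_kernel// -/(K _ _) powRM ?expR_ge0 ?(ltW (K0 _ _ _))//.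
  rewrite gauss_kernel_powR mulrA.
  over.
rewrite big_split/= prod_gauss_kernel mulrACA gauss_kernelM.
by rewrite [_ * y]mulrC.
Qed.

Theorem proposition1 (R : realType) (n : nat) (n_ge1 : (1 <= n)%N)
    (sigma theta0 : 'I_n -> R) (s : nat -> 'I_n -> R)
    (ell : 'I_n -> R -> R -> R)
    (a : nat -> 'M[R]_n)
    (mu : nat -> 'I_n -> R -> R)
    (sigma_gt0 : forall i, 0 < sigma i)
    (ellE : forall i x th, ell i x th = normal_pdf th (sigma i) x)
    (a_ge0 : forall k i j, 0 <= a k i j)
    (mu0 : forall i, mu 0%N i = normal_pdf (theta0 i) (sigma i))
    (muS : forall k i, mu k.+1 i =
       normalize (fun th =>
         (\prod_(j < n) (mu k j th `^ a k i j)) * ell i (s k.+1 i) th)) :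
  (forall k i, (1 <= k)%N -> is_gaussian (mu k i)) /\
  (forall E : nat -> rel 'I_n,
     (forall k, a k = comm_weights R (E k)) ->
     let A k := comm_weights R (E k) in
     let theta k i := density_mean (mu k i) in
     let tau k i := density_precision (mu k i) in
     let tau_obs i := (sigma i ^+ 2)^-1 in
     (forall i, theta 0%N i = theta0 i /\ tau 0%N i = tau_obs i) /\
     (forall k i,
        tau k.+1 i = \sum_(j < n) A k i j * tau k j + tau_obs i /\
        theta k.+1 i =
          (\sum_(j < n) A k i j * tau k j * theta k j
             + s k.+1 i * tau_obs i) / tau k.+1 i)).
Proof.
have step k (m sd : 'I_n -> R) (i : 'I_n) : (forall j, 0 < sd j) ->
    (forall j, mu k j = normal_pdf (m j) (sd j)) ->
    let tau := \sum_j a k i j * (sd j ^+ 2)^-1 + (sigma i ^+ 2)^-1 in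
    0 < tau /\ mu k.+1 i =
      normal_pdf ((\sum_j a k i j * (sd j ^+ 2)^-1 * m j
                   + s k.+1 i * (sigma i ^+ 2)^-1) / tau) (Num.sqrt tau)^-1.
  move=> sd0 muk tau.
  have [tau0 <-] := gaussian_update (a k i) m sd (s k.+1 i) (sigma i)
    (a_ge0 k i) sd0 (sigma_gt0 i).
  split=> //; rewrite muS; congr normalize; apply/funext => x.
  by rewrite ellE; congr (_ * _); apply: eq_bigr => j _; rewrite muk.
(* All agents are treated at once, as a step mixes the beliefs of all. *)
have gauss k : exists m sd : 'I_n -> R, (forall j, 0 < sd j) /\
    forall j, mu k j = normal_pdf (m j) (sd j).
  elim: k => [|k [m [sd [sd0 muk]]]]; first by exists theta0, sigma.
  pose tau i := \sum_j a k i j * (sd j ^+ 2)^-1 + (sigma i ^+ 2)^-1.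
  exists (fun i => (\sum_j a k i j * (sd j ^+ 2)^-1 * m j
                   + s k.+1 i * (sigma i ^+ 2)^-1) / tau i),
         (fun i => (Num.sqrt (tau i))^-1).
  split=> i; have [tau0 muSk] := step k m sd i sd0 muk; last exact: muSk.
  by rewrite invr_gt0 sqrtr_gt0.
split=> [k i _|E aE A theta tau tau_obs].
  by have [m [sd [sd0 muk]]] := gauss k; exists (m i), (sd i).
split=> [i|k i].
  by rewrite /theta /tau mu0 density_mean_normal_pdf// density_precision_normal_pdf.
have [m [sd [sd0 muk]]] := gauss k.
have tauk j : tau k j = (sd j ^+ 2)^-1.
  by rewrite /tau muk density_precision_normal_pdf.
have thetak j : theta k j = m j by rewrite /theta muk density_mean_normal_pdf.
have [t0 muSk] := step k m sd i sd0 muk.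
have tauS : tau k.+1 i = \sum_j a k i j * (sd j ^+ 2)^-1 + (sigma i ^+ 2)^-1.
  rewrite /tau muSk density_precision_normal_pdf ?invr_gt0 ?sqrtr_gt0//.
  by rewrite exprVn invrK sqr_sqrtr// ltW.
rewrite tauS; split.
  by congr (_ + _); apply: eq_bigr => j _; rewrite tauk aE.
rewrite /theta muSk density_mean_normal_pdf ?invr_gt0 ?sqrtr_gt0//.
congr ((_ + _) / _); apply: eq_bigr => j _.
by rewrite tauk -/(theta k j) thetak aE.
Qed.
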